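(* For every $\varepsilon>0$ there exists $n_0=n_0(\varepsilon)\in\mathbb{N}$ such that every graph $H$ on at least $n_0$ vertices satisfies $f_\ell(H)\ge (1-\varepsilon)(\mathsf{v}(H)+\kappa(H))$.
   Context: All graphs are finite, without loops or parallel edges. $\mathsf{v}(H)$ is the number of vertices of $H$. A graph $G$ is $k$-connected if $\mathsf{v}(G)\ge k+1$ and $G-X$ is connected for every $X\subseteq V(G)$ with $|X|<k$; $\kappa(H)$ denotes the vertex-connectivity of $H$, i.e. the largest $k$ such that $H$ is $k$-connected (so $\kappa(K_t)=t-1$). For a graph $H$, $f_\ell(H)$ denotes the maximum list chromatic number $\chi_\ell(G)$ over all graphs $G$ that do not contain $H$ as a minor. *)

(* Defs.v *)
From HB Require Import structures.
From mathcomp Require Import all_boot all_order all_algebra finmap.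
From mathcomp Require Import all_classical reals.

Set Implicit Arguments.
Unset Strict Implicit.
Unset Printing Implicit Defensive.

Record sgraph := SGraph {
  vertex :> finType;
  adj : rel vertex;
  adj_sym : symmetric adj;
  adj_irrefl : irreflexive adj }.

Definition nvertices (G : sgraph) : nat := #|G|.

(* The subgraph of G induced on A is connected; vacuously true for A empty. *)
Definition connected_on (G : sgraph) (A : {set G}) : bool :=
  [forall x in A, forall y in A,
     connect [rel u v : G | [&& u \in A, v \in A & adj u v]] x y].

Definition k_connected (G : sgraph) (k : nat) : bool :=
  (k.+1 <= nvertices G) && [forall X : {set G}, (#|X| < k) ==> connected_on (~: X)].

(* The range k < nvertices G loses nothing, since k_connected G k implies it.
   The graph without vertices, k-connected for no k, gets the value 0. *)
Definition kappa (G : sgraph) : nat := \max_(k < nvertices G | k_connected G k) k.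

(* H is a minor of G, in terms of the branch sets B x contracted to the
   vertices x of H. *)
Definition minor (H G : sgraph) : Prop :=
  exists B : H -> {set G},
    [/\ forall x, B x != finset.set0,
        forall x, connected_on (B x),
        forall x y, x != y -> [disjoint B x & B y] &
        forall x y, adj x y -> exists u v, [/\ u \in B x, v \in B y & adj u v]].

Definition list_colorable (G : sgraph) (L : G -> {fset nat}) : Prop :=
  exists c : G -> nat,
    (forall v, c v \in L v) /\ (forall u v, adj u v -> c u <> c v).

Definition choosable (G : sgraph) (k : nat) : Prop :=
  forall L : G -> {fset nat},
    (forall v, k <= #|` L v|) -> list_colorable L.

Lemma choosable_nvertices (G : sgraph) : choosable G (nvertices G).
Proof.
move=> L hL.
suff [c [cL cI]] : exists c : G -> nat,
    (forall v, v \in enum G -> c v \in L v) /\ {in enum G &, injective c}.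
  exists c; split=> [v|u v uv cuv]; first by apply: cL; rewrite mem_enum.
  have uv' : u = v by apply: cI; rewrite ?mem_enum.
  by move: uv; rewrite uv' adj_irrefl.
have: uniq (enum G) by apply: enum_uniq.
have: size (enum G) <= nvertices G by rewrite -cardE.
elim: (enum G) => [|v s IH] /= hs; first by exists (fun=> 0).
case/andP=> vs us; have [c [cL cI]] := IH (ltnW hs) us.
pose used : {fset nat} := [fset x in map c s]%fset.
have usedE x : (x \in used) = (x \in map c s) by rewrite !inE.
have [x xL xs] : exists2 x, x \in L v & x \notin map c s.
  have hlt : #|` used| < #|` L v|.
    apply: leq_trans (hL v); apply: leq_ltn_trans hs.
    rewrite -(size_map c); apply: leq_trans (size_undup (map c s)).
    by apply: uniq_leq_size => [|x]; rewrite ?fset_uniq // usedE mem_undup.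
  have /fsubsetPn[x xL] : ~~ (L v `<=` used)%fset.
    by apply/negP => /fsubset_leq_card; rewrite leqNgt hlt.
  by rewrite usedE => xs; exists x.
exists (fun u => if u == v then x else c u); split=> [u|u w].
  by rewrite inE; case: eqP => [->|_] //=; apply: cL.
rewrite !inE; case: eqP => [->|_] /=; case: eqP => [->|_] //= us' ws' e.
- by case/negP: xs; rewrite e map_f.
- by case/negP: xs; rewrite -e map_f.
- exact: cI.
Qed.

Lemma choosable_ex (G : sgraph) : exists k, `[< choosable G k >].
Proof. by exists (nvertices G); apply/asboolP; apply: choosable_nvertices. Qed.

Definition list_chromatic (G : sgraph) : nat := ex_minn (choosable_ex G).

Definition is_max_list_chromatic (H : sgraph) (m : nat) : Prop :=
  (exists2 G : sgraph, ~ minor H G & list_chromatic G = m) /\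
  (forall G : sgraph, ~ minor H G -> list_chromatic G <= m).

(* The maximum of list_chromatic over the H-minor-free graphs; the value is 0
   should there be no maximum, so a positive value entails that the maximum
   exists. *)
Definition f_ell (H : sgraph) : nat :=
  xget 0 [set m | is_max_list_chromatic H m]%classic.

Lemma f_ellE (H : sgraph) (m : nat) :
  is_max_list_chromatic H m -> f_ell H = m.
Proof.
move=> hm; rewrite /f_ell; case: xgetP => [m' _|/(_ m)//].
move: hm => [[G hG <-] hM] [[G' hG' <-] hM'].
by apply/eqP; rewrite eqn_leq hM ?hM'.
Qed.

(* Main.v *)
(* If kappa(H) is small compared with v(H), the complete graph on v(H) - 1 vertices
   suffices.  Otherwise take disjoint cliques A and B of sizes slightly below
   kappa(H) and v(H), and let F be a sparse random set of pairs in A x B.  Glue along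
   A one copy of B for every colouring of A, each copy joined to A by the pairs
   outside F.  With about |A| + |B| colours, and with the colours of its F-neighbours
   removed from the list of each vertex of B, the copy indexed by the actual colouring
   of A cannot be coloured.  An H-minor would, since |A| < kappa(H), leave a trace on
   A and on a single copy of B with quadratically many edges of H between small
   branch sets inside A and small ones inside B; with high probability F contains one
   of these boxes entirely.  The bounded degeneracy of H-minor-free graphs (Mader)
   ensures that the maximum defining f_ell exists. *)

Require Import Defs.
From mathcomp Require Import all_boot all_order all_algebra finmap zify.
From mathcomp Require Import boolp reals.

Set Implicit Arguments.
Unset Strict Implicit.
Unset Printing Implicit Defensive.

(** * Mader's theorem and greedy list colouring *)

Section Mader.
Variable G : sgraph.
Implicit Types (W U A : {set G}) (x y u v : G).

Definition nbrs W x : {set G} := [set y in W | adj x y].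

Definition twice_edges W : nat := \sum_(x in W) #|nbrs W x|.

Lemma card_nbrs W x : #|nbrs W x| = \sum_(y in W) adj x y.
Proof.
rewrite -sum1_card [RHS]big_mkcond [LHS]big_mkcond /=.
by apply: eq_bigr => y _; rewrite inE; case: (y \in W); case: (adj x y).
Qed.

Lemma twice_edges_rem W x : x \in W ->
  twice_edges W = twice_edges (W :\ x) + 2 * #|nbrs W x|.
Proof.
move=> xW; rewrite /twice_edges (big_setD1 x) //=.
have nE y : y \in W :\ x -> #|nbrs W y| = adj x y + #|nbrs (W :\ x) y|.
  by move=> _; rewrite !card_nbrs (big_setD1 x) //= adj_sym.
rewrite (eq_bigr _ nE) big_split /=.
suff -> : \sum_(i in W :\ x) adj x i = #|nbrs W x| by lia.
by rewrite card_nbrs [RHS](big_setD1 x) //= adj_irrefl.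
Qed.

Lemma connected_onP A :
  reflect {in A &, forall x y,
     connect [rel u v : G | [&& u \in A, v \in A & adj u v]] x y}
   (connected_on A).
Proof.
apply: (iffP forall_inP) => [cA x y xA yA|cA x xA].
  by have /forall_inP := cA x xA; apply.
by apply/forall_inP => y yA; apply: cA.
Qed.

Lemma connected_on1 x : connected_on [set x].
Proof. by apply/connected_onP => u v /set1P-> /set1P->. Qed.

Lemma connected_on_setU1 A u v :
  connected_on A -> u \in A -> adj u v -> connected_on (v |: A).
Proof.
move=> /connected_onP cA uA uv; apply/connected_onP.
set r := [rel _ _ | _].
have symr : connect_sym r.
  by apply: sym_connect_sym => x y; rewrite /= adj_sym andbCA.
have toU x : x \in v |: A -> connect r x u.
  case/setU1P => [->|xA]; first by rewrite symr connect1 //= !inE eqxx uA orbT.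
  apply: connect_sub (cA x u xA uA) => a b /and3P[aA bA ab].
  by rewrite connect1 //= !inE aA bA !orbT.
by move=> x y /toU xu /toU yu; apply: connect_trans xu _; rewrite symr.
Qed.

(** For connected [U], the neighbourhood in [W] of the vertex to which [U] is contracted. *)
Definition boundary W U : {set G} :=
  [set y in W :\: U | [exists x in U, adj x y]].

Lemma boundary1 W x : x \in W -> boundary W [set x] = nbrs W x.
Proof.
move=> xW; apply/setP => y; rewrite !inE.
have -> : [exists x0 in [set x], adj x0 y] = adj x y.
  apply/exists_inP/idP => [[z /set1P->]//|xy]; by exists x; rewrite ?set11.
by case: (eqVneq y x) => [->|_] /=; rewrite ?adj_irrefl ?andbF.
Qed.

(** Absorbing [v] removes it from the boundary and adds its neighbours outside [U]; those already in
    the boundary are counted only once. *)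
Lemma card_boundary_setU1 W U v : v \in boundary W U ->
  #|boundary W (v |: U)| + #|nbrs (boundary W U) v| + 1 =
  #|boundary W U| + #|nbrs (W :\: U) v|.
Proof.
move=> vb.
have vWU : v \in W :\: U by move: vb; rewrite inE => /andP[].
have -> : boundary W (v |: U) = (boundary W U :\ v) :|: nbrs (W :\: U) v.
  apply/setP => y; rewrite !inE.
  have -> : [exists x in v |: U, adj x y] = adj v y || [exists x in U, adj x y].
    apply/exists_inP/orP => [[x /setU1P[->|xU] xy]|[vy|/exists_inP[x xU xy]]].
    - by left.
    - by right; apply/exists_inP; exists x.
    - by exists v; rewrite ?setU11.
    - by exists x; rewrite // !inE xU orbT.
  case: eqP => [->|_] /=; first by rewrite adj_irrefl !andbF.
  by case: (y \in U); case: (y \in W); case: (adj v y);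
     case: [exists x in U, adj x y].
rewrite cardsU (cardsD1 v (boundary W U)) vb.
have -> : (boundary W U :\ v) :&: nbrs (W :\: U) v = nbrs (boundary W U) v.
  apply/setP => y; rewrite !inE.
  case: eqP => [->|_] /=; first by rewrite adj_irrefl !andbF.
  by case: (y \in U); case: (y \in W); case: (adj v y);
     case: [exists x in U, adj x y].
have : #|nbrs (boundary W U) v| <= #|nbrs (W :\: U) v|.
  apply: subset_leq_card; apply/subsetP => y; rewrite !inE.
  by case/andP=> /andP[-> _] ->.
lia.
Qed.

(** Indexing by [nat] lets the induction on [t] append a branch set without changing types. *)
Definition clique_minor_in W t := exists B : nat -> {set G},
  (forall i, i < t -> [/\ B i != finset.set0, connected_on (B i) & B i \subset W]) /\
  (forall i j, i < t -> j < t -> i != j -> [disjoint B i & B j] /\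
    exists u v, [/\ u \in B i, v \in B j & adj u v]).

(* Contract a maximal connected set U keeping the edge density of W: maximality
   forces every vertex adjacent to U to have large degree inside the boundary of U,
   where a smaller clique minor is found; U is the additional branch set. *)
Lemma clique_minor_of_dense t W : W != finset.set0 ->
  2 * 2 ^ t * #|W| <= twice_edges W -> clique_minor_in W t.
Proof.
elim: t W => [|t IHt] W; first by move=> _ _; exists (fun=> finset.set0); split.
have [n] := ubnP #|W|; elim: n W => // n IHn W ltWn W0 dW.
(* The inequality says that contracting [U] to one vertex leaves average degree at least
   [2 * 2 ^ t.+1]. *)
pose P U := [&& U \subset W, U != finset.set0, connected_on U &
  2 * 2 ^ t.+1 * (#|W :\: U| + 1) <= twice_edges (W :\: U) + 2 * #|boundary W U|].
have [x xW] := set0Pn _ W0.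
have Px : P [set x].
  rewrite /P sub1set xW connected_on1 -card_gt0 cards1 boundary1 //=.
  rewrite -twice_edges_rem //.
  by have := cardsD1 x W; rewrite xW addnC => <-.
have [U /maxsetP[/and4P[UW U0 cU dU] Umax] _] := maxset_exists Px.
(* If nothing in [W] outside [U] is adjacent to [U], the smaller set [W :\: U] is itself dense
   enough. *)
have [b0|b0] := eqVneq (boundary W U) finset.set0.
  move: dU; rewrite b0 cards0 muln0 addn0 => dU.
  have D0 : W :\: U != finset.set0.
    apply: contraTneq dU => ->.
    by rewrite /twice_edges big_set0 leqNgt muln_gt0 muln_gt0 expn_gt0 addn1.
  have ltD : #|W :\: U| < n.
    have := cardsID U W; rewrite (setIidPr UW).
    by move: U0 ltWn; rewrite -card_gt0; lia.
  have [|B [B1 B2]] := IHn (W :\: U) ltD D0; first by lia.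
  exists B; split=> // i lti; have [? ? sB] := B1 i lti; split=> //.
  exact: subset_trans sB (subsetDl _ _).
(* Absorbing [v] into [U] loses one vertex, the edge to [v], and one edge per common neighbour; as
   this breaks the density bound, common neighbours are many. *)
have big_deg v : v \in boundary W U -> 2 ^ t.+1 <= #|nbrs (boundary W U) v|.
  move=> vb; have := vb; rewrite !inE => /andP[/andP[vU vW] /exists_inP[u uU uv]].
  have : ~~ P (v |: U).
    apply/negP => PvU; have := Umax _ PvU (subsetUr _ _) => E.
    by move: vU; rewrite -E setU11.
  rewrite /P subUset sub1set vW UW /= (connected_on_setU1 cU uU uv) /=.
  have -> /= : v |: U != finset.set0 by apply/set0Pn; exists v; rewrite setU11.
  rewrite -ltnNge.
  have vWU : v \in W :\: U by rewrite !inE vU vW.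
  have -> : W :\: (v |: U) = (W :\: U) :\ v.
    by apply/setP => y; rewrite !inE negb_or; case: (y == v); case: (y \in U).
  have := card_boundary_setU1 vb.
  move: dU; rewrite (twice_edges_rem vWU) (cardsD1 v (W :\: U)) vWU.
  set k := 2 ^ t.+1; set d := #|(W :\: U) :\ v|; move: d => d /=.
  rewrite !mulnDr; lia.
have [|B [B1 B2]] := IHt _ b0.
  rewrite -expnS mulnC -sum_nat_const; exact: leq_sum.
exists (fun i => if i < t then B i else U); split=> [i _|i j].
  case: ifP => [/B1[? ? sB]|//]; split=> //; apply: subset_trans sB _.
  by apply/subsetP => y; rewrite !inE => /andP[/andP[]].
have disj i' : i' < t -> [disjoint B i' & U].
  case/B1=> _ _ sB; rewrite disjoint_subset; apply: subset_trans sB _.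
  by apply/subsetP => y; rewrite !inE => /andP[/andP[]].
have adjU i' : i' < t -> exists u v, [/\ u \in B i', v \in U & adj u v].
  case/B1=> /set0Pn[y yB] _ /subsetP/(_ _ yB); rewrite inE.
  by case/andP=> _ /exists_inP[u uU uy]; exists y, u; rewrite adj_sym.
move=> lti ltj ij; case: ltnP => hi; case: ltnP => hj.
- exact: B2.
- by split; [apply: disj | apply: adjU].
- split; first by rewrite disjoint_sym; apply: disj.
  by have [u [v [? ? ?]]] := adjU _ hj; exists v, u; rewrite adj_sym.
- by move: ij; rewrite (_ : i = j) ?eqxx //; lia.
Qed.

(** Greedy colouring: once [W] without [x] is coloured, the fewer than [d] neighbours of [x] leave a
    colour of its list free. *)
Lemma choosable_of_degenerate d :
  (forall W, W != finset.set0 -> exists2 x, x \in W & #|nbrs W x| < d) ->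
  choosable G d.
Proof.
move=> degG L hL.
suff /(_ finset.setT) [c [cL cP]] : forall W, exists c : G -> nat,
    {in W, forall v, c v \in L v} /\ {in W &, forall u v, adj u v -> c u <> c v}.
  by exists c; split=> [v|u v]; [apply: cL | apply: cP]; rewrite inE.
move=> W; have [n] := ubnP #|W|; elim: n W => // n IHn W ltWn.
have [->|W0] := eqVneq W finset.set0.
  by exists (fun=> 0); split=> [v|u v]; rewrite inE.
have [x xW dx] := degG W W0.
have [|c [cL cP]] := IHn (W :\ x); first by move: ltWn; rewrite (cardsD1 x W) xW.
have /hasP[k kL kN] :
    has (fun k => k \notin [seq c y | y <- enum (nbrs W x)]) (L x).
  apply/negPn/negP => /hasPn sL.
  have : size (L x) <= size [seq c y | y <- enum (nbrs W x)].
    by apply: uniq_leq_size (fset_uniq _) _ => k /sL /negPn.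
  by rewrite size_map -cardE leqNgt (leq_trans dx (hL x)).
have kP y : y \in W -> adj x y -> k <> c y.
  move=> yW xy E; move/negP: kN; apply; rewrite E; apply: map_f.
  by rewrite mem_enum !inE yW.
exists (fun y => if y == x then k else c y); split=> [v vW|u v uW vW].
  by case: eqP => [->//|/eqP vx]; apply: cL; rewrite !inE vx.
case: eqP => [->|/eqP ux]; case: eqP => [->|/eqP vx].
- by rewrite adj_irrefl.
- exact: kP.
- by rewrite adj_sym => /(kP _ uW) + /esym.
- by apply: cP; rewrite !inE ?ux ?vx.
Qed.

Lemma minor_of_clique_minor (H : sgraph) W :
  clique_minor_in W (nvertices H) -> minor H G.
Proof.
case=> B [B1 B2]; exists (fun h => B (enum_rank h)).
have rk (h : H) : enum_rank h < nvertices H by apply: ltn_ord.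
have rkN (x y : H) : x != y -> (enum_rank x : nat) != enum_rank y.
  by apply: contra_neq => /val_inj/enum_rank_inj.
split=> [h|h|x y xy|x y xy].
- by case: (B1 _ (rk h)).
- by case: (B1 _ (rk h)).
- by case: (B2 _ _ (rk x) (rk y) (rkN _ _ xy)).
- have xNy : x != y by apply: contraTneq xy => ->; rewrite adj_irrefl.
  by case: (B2 _ _ (rk x) (rk y) (rkN _ _ xNy)).
Qed.

Lemma minor_free_choosable (H : sgraph) :
  ~ minor H G -> choosable G (2 * 2 ^ nvertices H).
Proof.
move=> nHG; apply: choosable_of_degenerate => W W0.
have [/exists_inP//|] := boolP [exists x in W, #|nbrs W x| < 2 * 2 ^ nvertices H].
rewrite negb_exists_in => /forall_inP dW; case: nHG.
apply: (@minor_of_clique_minor H W); apply: clique_minor_of_dense => //.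
by rewrite mulnC -sum_nat_const; apply: leq_sum => x /dW; rewrite -leqNgt.
Qed.

End Mader.

(** * Existence of the maximum defining [f_ell] *)

Lemma list_chromatic_choosable (G : sgraph) : choosable G (list_chromatic G).
Proof. by rewrite /list_chromatic; case: ex_minnP => m /asboolP. Qed.

Lemma list_chromatic_le (G : sgraph) k : choosable G k -> list_chromatic G <= k.
Proof.
by rewrite /list_chromatic; case: ex_minnP => m _ mP cG; apply/mP/asboolP.
Qed.

(** The choosability bound depends on [H] only, so the maximum is attained and [f_ell] is not its
    default value. *)
Lemma list_chromatic_le_f_ell (H G : sgraph) :
  ~ minor H G -> list_chromatic G <= f_ell H.
Proof.
move=> nHG.
pose P m := `[< exists2 G' : sgraph, ~ minor H G' & list_chromatic G' = m >].
have exP : exists m, P m by exists (list_chromatic G); apply/asboolP; exists G.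
have bndP m : P m -> m <= 2 * 2 ^ nvertices H.
  by case/asboolP=> G' nG' <-; apply/list_chromatic_le/minor_free_choosable.
case: (ex_maxnP exP bndP) => m /asboolP Pm mP.
have maxP G' : ~ minor H G' -> list_chromatic G' <= m.
  by move=> nG'; apply: mP; apply/asboolP; exists G'.
by rewrite (@f_ellE H m); [apply: maxP | split].
Qed.

(* In probabilistic terms: for f uniformly random, the events that f is not
   constantly i on R j are independent, each of probability at most 1 - q ^- r. *)
Lemma card_avoid_const (T J : finType) (q r : nat) (i : 'I_q) (R : J -> {set T})
    (s : seq J) :
  uniq s -> {in s, forall j, #|R j| <= r} ->
  {in s &, forall j j', j != j' -> [disjoint R j & R j']} ->
  #|[set f : {ffun T -> 'I_q} | all (fun j => [exists x in R j, f x != i]) s]|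
    * (q ^ r) ^ size s <= (q ^ r).-1 ^ size s * q ^ #|T|.
Proof.
have q_gt0 : 0 < q by case: q i => [[]|].
elim: s => [_ _ _|j s IHs] /=.
  rewrite !expn0 muln1 mul1n -[X in _ <= X ^ _](card_ord q) -card_ffun.
  exact: max_card.
case/andP=> js us rs ds.
set S := [set f : {ffun T -> 'I_q} | all _ s] in IHs.
have {}IHs : #|S| * (q ^ r) ^ size s <= (q ^ r).-1 ^ size s * q ^ #|T|.
  apply: IHs => // [j' j's|j1 j2 j1s j2s]; first by apply: rs; rewrite inE j's orbT.
  by apply: ds; rewrite inE ?j1s ?j2s orbT.
set S1 := [set f | _].
pose S0 := [set f in S | [forall x in R j, f x == i]].
have S01 : #|S| = #|S0| + #|S1|.
  rewrite -(cardsID [set f : {ffun T -> 'I_q} | [forall x in R j, f x == i]] S).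
  congr (_ + _); apply: eq_card => f; rewrite !inE ?negb_forall_in.
    by rewrite andbC.
  by [].
have S0S : #|S| <= #|S0| * q ^ r.
  (* The pair of [over f] and [rest f] determines [f]; [over f] stays in [S] because [R j] is
     disjoint from the other sets. *)
  pose over (f : {ffun T -> 'I_q}) := [ffun x => if x \in R j then i else f x].
  pose rest (f : {ffun T -> 'I_q}) := [ffun x => if x \in R j then f x else i].
  have injg : {in S &, injective (fun f => (over f, rest f))}.
    move=> f g _ _ [/ffunP o /ffunP e]; apply/ffunP => x.
    by have := o x; have := e x; rewrite !ffunE; case: ifP.
  rewrite -(card_in_imset injg).
  pose Z := [set f in pffun_on i (R j) (@predT 'I_q)].
  have cZ : #|Z| <= q ^ r.
    rewrite cardsE card_pffun_on cardT size_enum_ord.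
    by rewrite leq_pexp2l // rs // mem_head.
  apply: leq_trans (leq_mul (leqnn _) cZ); rewrite -cardsX.
  apply/subset_leq_card/subsetP => _ /imsetP[f fS ->]; rewrite in_setX.
  apply/andP; split; last first.
    rewrite inE; apply/pffun_onP; split=> //; apply/supportP => x xR.
    by rewrite ffunE (negPf xR).
  rewrite !inE /=; apply/andP; split; last by apply/forall_inP => x xR; rewrite ffunE xR.
  apply/allP => j' j's; move: fS; rewrite inE => /allP/(_ _ j's).
  case/exists_inP=> x xR fx; apply/exists_inP; exists x => //; rewrite ffunE.
  have jj' : j' != j by apply: contraNneq js => <-.
  have dj : [disjoint R j' & R j] by apply: ds; rewrite // inE ?eqxx ?j's ?orbT.
  by rewrite (disjointFr dj xR).
have D_gt0 : 0 < q ^ r by rewrite expn_gt0 q_gt0.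
rewrite !expnS; move: IHs S01 S0S D_gt0; set D := q ^ r.
set X := D ^ size s; set Y := D.-1 ^ size s; set Z := q ^ #|T|.
move=> IHs S01 S0S D_gt0.
have S1S : #|S1| * D <= #|S| * D.-1.
  by move: S01 S0S D_gt0; case: (D) => // d; rewrite mulnS => -> /=; rewrite !mulnS; lia.
have := leq_mul (leqnn D.-1) IHs; have := leq_mul S1S (leqnn X).
move=> h1 h2; rewrite mulnA; apply: leq_trans h1 _.
by rewrite mulnAC mulnC -[_ * Y * Z]mulnA.
Qed.

(** * The sparse random set of pairs *)

Section SparseBipartite.
Variables (H : sgraph) (A B : finType) (q k s kap : nat).
Hypothesis deg_ge : forall h : H, kap <= #|[set h' | adj h h']|.
Hypothesis AB_le : #|A| + #|B| <= k * s.
Hypothesis A_le : #|A| + 2 * s <= kap.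
Hypothesis B_le : #|B| + 2 * s <= nvertices H.

(** A labelling is a possible trace of an [H]-minor on [A] and one copy of [B]; [None] marks
    vertices in no branch set. *)
Let lab := {ffun A + B -> option H}.
Implicit Type phi : lab.

Definition label_class phi h := [set z | phi z == Some h].
Definition large_labels phi := [set h | k < #|label_class phi h|].
Definition left_labels phi := [set h | ~~ (k < #|label_class phi h|) &
  [forall b, phi (inr b) != Some h]].
Definition right_labels phi := [set h | ~~ (k < #|label_class phi h|) &
  [forall a, phi (inl a) != Some h]].
Definition edge_labels phi :=
  [set p : H * H | [&& adj p.1 p.2, p.1 \in left_labels phi & p.2 \in right_labels phi]].
(** The pairs that could realise the edge [p] of [H]; boxes of distinct [p] are disjoint, whence
    independence. *)
Definition label_rect phi (p : H * H) : {set A * B} :=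
  setX [set a | phi (inl a) == Some p.1] [set b | phi (inr b) == Some p.2].

Lemma card_large_labels phi : #|large_labels phi| <= s.
Proof.
have : #|large_labels phi| * k.+1 <= k * s.
  apply: leq_trans AB_le; rewrite -card_sum.
  have sum_le : \sum_(h in large_labels phi) #|label_class phi h| <= #|{: A + B}|.
    under eq_bigr do rewrite -sum1_card.
    rewrite (exchange_big_dep predT) //= -[X in _ <= X]sum1_card.
    apply: leq_sum => z _; rewrite sum1_card.
    apply: leq_trans (_ : #|if phi z is Some h then [set h] else finset.set0| <= 1).
      apply/subset_leq_card/subsetP => h; rewrite unfold_in => /andP[_].
      by rewrite inE => /eqP->; rewrite set11.
    by case: (phi z) => [h|]; rewrite ?cards1 ?cards0.
  apply: leq_trans sum_le; rewrite -sum_nat_const.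
  by apply: leq_sum => h; rewrite inE.
move=> le_ks; rewrite leqNgt; apply/negP => lt_s.
have := leq_trans (leq_mul lt_s (leqnn k.+1)) le_ks.
by rewrite mulSn mulnS mulnC; lia.
Qed.

Lemma card_image_label (T : finType) (g : T -> option H) :
  #|[set h | [exists t, g t == Some h]]| <= #|T|.
Proof.
have Some_injH : injective (@Some H) by move=> ? ? [].
rewrite -(card_imset _ Some_injH).
apply: leq_trans (leq_imset_card g T); apply/subset_leq_card/subsetP => _ /imsetP[h + ->].
by rewrite inE => /existsP[t /eqP gt]; apply/imsetP; exists t.
Qed.

Lemma card_small_free_labels phi (T : finType) (j : T -> A + B) :
  #|~: [set h | ~~ (k < #|label_class phi h|) & [forall t, phi (j t) != Some h]]|
    <= s + #|T|.
Proof.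
apply: leq_trans (leq_add (card_large_labels phi) (card_image_label (phi \o j))).
apply: leq_trans (leq_card_setU _ _); apply/subset_leq_card/subsetP => h.
rewrite !inE negb_and negbK negb_forall => /orP[->//|/existsP[t]].
by rewrite negbK => ht; apply/orP; right; apply/existsP; exists t.
Qed.

(** All but [s + #|B|] labels are left labels, so at least [s] are; each has at least [kap]
    neighbours, of which at most [s + #|A|] are not right labels. *)
Lemma card_edge_labels phi : s * s <= #|edge_labels phi|.
Proof.
have L_ge : s <= #|left_labels phi|.
  have := card_small_free_labels phi inr; rewrite -/(left_labels phi).
  by have := cardsC (left_labels phi); move: B_le; rewrite /nvertices; lia.
have R_ge : #|~: right_labels phi| <= s + #|A| := card_small_free_labels phi inl.
have -> : #|edge_labels phi| =
    \sum_(h in left_labels phi) #|[set h' | adj h h'] :&: right_labels phi|.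
  under eq_bigr do rewrite -sum1_card.
  rewrite pair_big_dep /= -sum1_card; apply: eq_bigl => p.
  by rewrite !inE; case: (adj _ _); rewrite ?andbF ?andbT.
apply: leq_trans (_ : \sum_(h in left_labels phi) s <= _).
  by rewrite sum_nat_const leq_mul2r L_ge orbT.
apply: leq_sum => h _.
have := cardsID (right_labels phi) [set h' | adj h h'].
have : #|[set h' | adj h h'] :\: right_labels phi| <= #|~: right_labels phi|.
  by apply: subset_leq_card; rewrite setDE subsetIr.
by have := deg_ge h; move: A_le R_ge; lia.
Qed.

(** Colour class [i] of [f] is a candidate for [F]; it fails [phi] when it contains no box
    entirely. *)
Definition bad_colorings phi (i : 'I_q) := [set f : {ffun A * B -> 'I_q} |
  all (fun p => [exists x in label_rect phi p, f x != i]) (enum (edge_labels phi))].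

Lemma card_bad_colorings phi i :
  #|bad_colorings phi i| * (q ^ (k * k)) ^ (s * s)
    <= (q ^ (k * k)).-1 ^ (s * s) * q ^ (#|A| * #|B|).
Proof.
have q_gt0 : 0 < q by case: q i => [[]|].
have inlI : injective (@inl A B) by move=> ? ? [].
have inrI : injective (@inr A B) by move=> ? ? [].
have D_gt0 : 0 < q ^ (k * k) by rewrite expn_gt0 q_gt0.
have le_s := card_edge_labels phi.
have : #|bad_colorings phi i| * (q ^ (k * k)) ^ #|edge_labels phi|
    <= (q ^ (k * k)).-1 ^ #|edge_labels phi| * q ^ (#|A| * #|B|).
  rewrite [X in _ ^ X]cardE [X in _.-1 ^ X]cardE -card_prod.
  apply: card_avoid_const => [|p|p p']; first exact: enum_uniq.
    rewrite mem_enum !inE => /and3P[_ /andP[+ _] /andP[+ _]]; rewrite -!leqNgt => h1 h2.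
    rewrite cardsX leq_mul //.
      apply: leq_trans h1; rewrite -(card_imset _ inlI).
      by apply/subset_leq_card/subsetP => _ /imsetP[a + ->]; rewrite !inE.
    apply: leq_trans h2; rewrite -(card_imset _ inrI).
    by apply/subset_leq_card/subsetP => _ /imsetP[a + ->]; rewrite !inE.
  move=> _ _; apply: contraNT => /pred0Pn[[a b]] /=; rewrite !inE /=.
  case/andP=> /andP[/eqP a1 /eqP b1] /andP[]; rewrite a1 b1.
  by case: p p' {a1 b1} => [x y] [x' y'] /= /eqP[->] /eqP[->].
set D := q ^ (k * k) in D_gt0 *.
(* The boxes beyond [s * s] are discarded by bounding their factor [D.-1 ^ d] by [D ^ d]. *)
rewrite -(subnKC le_s) !expnD; set d := _ - _.
have le_pred : D.-1 ^ d <= D ^ d by case: (d) => // d'; rewrite leq_exp2r ?leq_pred.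
have Dd_gt0 : 0 < D ^ d by rewrite expn_gt0 D_gt0.
move=> h; rewrite -(leq_pmul2r Dd_gt0); move: h; rewrite -!mulnA => h; apply: leq_trans h _.
by rewrite leq_mul2l [X in _ <= X]mulnC leq_mul2r le_pred !orbT.
Qed.

(** A union bound over all labellings and all [q] colours gives one colouring whose classes all
    work; the smallest class then has density at most [1/q], with no concentration estimate. *)
Lemma sparse_bipartite :
  0 < q ->
  q * (nvertices H).+1 ^ (#|A| + #|B|) * (q ^ (k * k)).-1 ^ (s * s)
    < (q ^ (k * k)) ^ (s * s) ->
  exists F : {set A * B}, q * #|F| <= #|A| * #|B| /\
    forall phi, exists h h', [/\ adj h h',
      forall b, phi (inr b) <> Some h, forall a, phi (inl a) <> Some h' &
      forall a b, phi (inl a) = Some h -> phi (inr b) = Some h' -> (a, b) \in F].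
Proof.
move=> q_gt0 num.
have [f fP] : exists f : {ffun A * B -> 'I_q},
    forall phi i, f \notin bad_colorings phi i.
  pose U := \bigcup_(p : lab * 'I_q) bad_colorings p.1 p.2.
  have [f fU|allU] := pickP (mem (~: U)).
    exists f => phi i; apply: contraL fU => fb; rewrite /= inE negbK.
    by apply/bigcupP; exists (phi, i).
  have UT : #|U| = q ^ (#|A| * #|B|).
    have := cardsC U; rewrite (eq_card0 allU) addn0 => ->.
    by rewrite card_ffun card_ord card_prod.
  have D_gt0 : 0 < q ^ (k * k) by rewrite expn_gt0 q_gt0.
  have : #|U| * (q ^ (k * k)) ^ (s * s) <= \sum_(p : lab * 'I_q)
      (q ^ (k * k)).-1 ^ (s * s) * q ^ (#|A| * #|B|).
    have leU : #|U| <= \sum_(p : lab * 'I_q) #|bad_colorings p.1 p.2|.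
      rewrite /U; elim/big_rec2: _ => [|p V n _ leV]; first by rewrite cards0.
      by apply: leq_trans (leq_card_setU _ _) _; rewrite leq_add2l.
    apply: leq_trans (leq_mul leU (leqnn _)) _.
    by rewrite big_distrl; apply: leq_sum => p _; apply: card_bad_colorings.
  rewrite UT sum_nat_const card_prod card_ffun card_option card_ord card_sum.
  rewrite mulnA [X in _ <= X]mulnC leq_pmul2l ?expn_gt0 ?q_gt0 //.
  by rewrite leqNgt [_ ^ _ * q]mulnC num.
pose F i := [set x | f x == i].
have [i Fi] : exists i, q * #|F i| <= #|A| * #|B|.
  pose i0 := Ordinal q_gt0.
  pose i := [arg min_(i < i0) #|F i|]; exists i.
  have im j : #|F i| <= #|F j|.
    by rewrite /i; case: arg_minnP => // l _; apply.
  rewrite -card_prod -(card_ord q) -sum_nat_const.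
  apply: leq_trans (_ : \sum_j #|F j| <= _); first exact: leq_sum.
  rewrite -sum1_card (partition_big f predT) //=.
  by apply: leq_sum => j _; rewrite -sum1dep_card.
exists (F i); split=> // phi.
have := fP phi i; rewrite inE -has_predC => /hasP[[h h']].
rewrite mem_enum !inE /= => /and3P[hh' /andP[_ /forallP hb] /andP[_ /forallP ha]].
rewrite negb_exists_in => /forall_inP hF; exists h, h'; split=> //.
- by move=> b /eqP; apply/negP.
- by move=> a /eqP; apply/negP.
move=> a b pa pb; rewrite inE -[_ == _]negbK; apply: hF.
by rewrite !inE /= pa pb !eqxx.
Qed.

End SparseBipartite.

(** * The glued graph and its lack of an [H]-minor *)

Lemma connect_eq (T : finType) (U : eqType) (r : rel T) (g : T -> U) x y :
  (forall u v, r u v -> g u = g v) -> connect r x y -> g x = g y.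
Proof.
move=> rg cxy; have cl : closed r [pred z | g z == g x].
  by move=> u v /rg uv; rewrite !inE uv.
by have := closed_connect cl cxy; rewrite !inE eqxx => /esym/eqP/esym.
Qed.

Section Glue.
Variables (A B C : finType) (F : {set A * B}).

Definition glue_rel : rel (A + B * C)%type := fun x y =>
  match x, y with
  | inl a, inl a' => a != a'
  | inl a, inr p => (a, p.1) \notin F
  | inr p, inl a => (a, p.1) \notin F
  | inr p, inr p' => (p.2 == p'.2) && (p.1 != p'.1)
  end.

Lemma glue_rel_sym : symmetric glue_rel.
Proof. by move=> [a|[b c]] [a'|[b' c']] //=; rewrite eq_sym // [b == _]eq_sym. Qed.

Lemma glue_rel_irrefl : irreflexive glue_rel.
Proof. by move=> [a|[b c]] /=; rewrite !eqxx. Qed.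

Definition glue : sgraph := SGraph glue_rel_sym glue_rel_irrefl.

Definition copy_of (z : glue) : option C := if z is inr p then Some p.2 else None.

(* As |A| is below the connectivity of H, the branch sets avoiding A all lie in
   one copy of B; the trace on A and on that copy is the labelling phi. *)
Lemma glue_minor_free (H : sgraph) kap :
  k_connected H kap -> #|A| < kap ->
  (forall phi : {ffun A + B -> option H}, exists h h', [/\ adj h h',
      forall b, phi (inr b) <> Some h, forall a, phi (inl a) <> Some h' &
      forall a b, phi (inl a) = Some h -> phi (inr b) = Some h' -> (a, b) \in F]) ->
  ~ minor H glue.
Proof.
move=> /andP[ltkN /forall_inP conH] ltAk FP [Br [Br0 Brc Brd Bra]].
have Br_inj h h' z : z \in Br h -> z \in Br h' -> h = h'.
  move=> zh zh'; apply/eqP/negPn/negP => /Brd /pred0P/(_ z) /=.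
  by rewrite zh zh'.
pose label z := [pick h | z \in Br h].
have labelP z h : reflect (label z = Some h) (z \in Br h).
  rewrite /label; case: pickP => [h' zh'|zN]; apply: (iffP idP) => //.
  - by move=> zh; rewrite (Br_inj _ _ _ zh zh').
  - by case=> <-.
  - by rewrite zN.
(* The vertices of [H] whose branch sets meet [A]: fewer than [kap], so [H] stays connected without
   them. *)
pose X := [set h | [exists a, label (inl a : glue) == Some h]].
have ltXk : #|X| < kap.
  by apply: leq_ltn_trans ltAk; apply: (card_image_label (fun a => label (inl a : glue))).
have notX h a : h \notin X -> (inl a : glue) \notin Br h.
  move=> hX; apply: contra hX => /labelP ah; rewrite inE; apply/existsP.
  by exists a; rewrite ah.
have copyBr h u v : h \notin X -> u \in Br h -> v \in Br h -> copy_of u = copy_of v.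
  move=> hX uh vh; have /connected_onP/(_ u v uh vh) := Brc h.
  apply: connect_eq => {u v uh vh}u v /and3P[].
  case: u => [a|p]; first by rewrite (negPf (notX _ _ hX)).
  case: v => [a|p']; first by rewrite (negPf (notX _ _ hX)).
  by move=> _ _ /andP[/eqP /= ->].
(* The copy containing a branch set that avoids [A]; the default [None] does not occur, branch sets
   being nonempty. *)
pose cp h := if [pick z in Br h] is Some z then copy_of z else None.
have cpE h z : h \notin X -> z \in Br h -> copy_of z = cp h.
  rewrite /cp => hX zh; case: pickP => [z' z'h|/(_ z)]; last by rewrite zh.
  exact: copyBr hX zh z'h.
have [h0 h0X] : exists h0, h0 \notin X.
  have : 0 < #|~: X| by have := cardsC X; move: ltkN; rewrite /nvertices; lia.
  by case/card_gt0P=> h0; rewrite in_setC; exists h0.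
have cp0 h : h \notin X -> cp h = cp h0.
  move=> hX; have /connected_onP/(_ h h0) := conH X ltXk; rewrite !in_setC => /(_ hX h0X).
  apply: connect_eq => {h hX}h h' /and3P[]; rewrite !in_setC => hX h'X /Bra[u [v [uh vh]]].
  rewrite -(cpE _ _ hX uh) -(cpE _ _ h'X vh).
  case: u uh => [a|p]; first by rewrite (negPf (notX _ _ hX)).
  case: v vh => [a|p']; first by rewrite (negPf (notX _ _ h'X)).
  by move=> _ _ /andP[/eqP /= ->].
have [c cpc] : exists c, cp h0 = Some c.
  have [[a|p] zh] := set0Pn _ (Br0 h0); first by have := notX _ a h0X; rewrite zh.
  by exists p.2; rewrite -(cpE _ _ h0X zh).
pose emb (z : A + B) : glue := match z with inl a => inl a | inr b => inr (b, c) end.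
(* The branch set of [h'] lies in copy [c], which that of [h] misses; an edge between them must come
   from [A], but all such pairs are in [F]. *)
have [h [h' [hh' hb h'a hF]]] := FP [ffun z => label (emb z)].
have h'X : h' \notin X.
  rewrite inE; apply/existsP => -[a /eqP ah]; apply: (h'a a); by rewrite ffunE.
have [u [v [uh vh uv]]] := Bra _ _ hh'.
case: v vh uv => [a vh|[b c'] vh uv]; first by have := notX _ a h'X; rewrite vh.
have E : c' = c.
  by have := cpE _ _ h'X vh; rewrite (cp0 _ h'X) cpc => -[].
subst c'.
case: u uh uv => [a uh|[b' c'] uh /andP[/eqP/= E _]]; last first.
  by subst c'; apply: (hb b'); rewrite ffunE; apply/labelP.
by move/negP; apply; apply: hF; rewrite ffunE; apply/labelP.
Qed.

End Glue.

(** * Lists that defeat every colouring of the glued graph *)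

Definition small_degree (A B : finType) (F : {set A * B}) d : {set B} :=
  [set b | #|[set a | (a, b) \in F]| <= d].

Lemma card_small_degree (A B : finType) (F : {set A * B}) d :
  #|~: small_degree F d| * d.+1 <= #|F|.
Proof.
have -> : #|F| = \sum_b #|[set a | (a, b) \in F]|.
  under eq_bigr do rewrite -sum1_card.
  rewrite (exchange_big_dep predT) //= pair_big_dep /= -sum1_card.
  by apply: eq_bigl => -[a b]; rewrite !inE.
rewrite -sum_nat_const [X in _ <= X](bigID (mem (~: small_degree F d))) /=.
apply: leq_trans (leq_addr _ _); apply: leq_sum => b.
by rewrite !inE -ltnNge.
Qed.

Lemma choosable_mono (G : sgraph) k k' : k <= k' -> choosable G k -> choosable G k'.
Proof. by move=> kk' ch L hL; apply: ch => v; apply: leq_trans kk' (hL v). Qed.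

Lemma lt_list_chromatic (G : sgraph) k : ~ choosable G k -> k < list_chromatic G.
Proof.
move=> nch; rewrite ltnNge; apply/negP => le; apply: nch.
exact: choosable_mono le (@list_chromatic_choosable G).
Qed.

Lemma card_fset_filter_notin K (t : seq nat) :
  K <= #|` [fset x in [seq x <- iota 0 K | x \notin t]]%fset| + size t.
Proof.
rewrite card_fseq undup_id ?filter_uniq ?iota_uniq //.
have : size [seq x <- iota 0 K | x \in t] <= size t.
  apply: uniq_leq_size; first by rewrite filter_uniq ?iota_uniq.
  by move=> x; rewrite mem_filter => /andP[].
rewrite !size_filter => le_t; have := count_predC [in t] (iota 0 K).
by rewrite size_iota => E; rewrite -[X in X <= _]E addnC leq_add2l.
Qed.

(* The copies of B are indexed by the colourings of A: in the copy indexed by the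
   actual colouring of A, every vertex of small degree must avoid the colours of all
   of A, those of its F-neighbours because they were taken out of its list. *)
Lemma glue_not_choosable (A B : finType) (F : {set A * B}) d K k :
  K < #|A| + #|small_degree F d| -> k + d <= K ->
  ~ choosable (glue {ffun A -> 'I_K} F) k.
Proof.
set Sd := small_degree F d; move=> ltK le_K.
(* Vertices with more than [d] [F]-neighbours keep the full list, so no list loses more than [d]
   colours. *)
pose forb (p : B * {ffun A -> 'I_K}) : seq nat :=
  if p.1 \in Sd then [seq nat_of_ord (p.2 a) | a <- enum [set a | (a, p.1) \in F]]
  else [::].
pose L (z : glue {ffun A -> 'I_K} F) : {fset nat} :=
  [fset x in [seq x <- iota 0 K |
     x \notin (if z is inr p then forb p else [::])]]%fset.
have LE z x : (x \in L z) =
    (x \notin (if z is inr p then forb p else [::])) && (x < K).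
  by rewrite !inE mem_filter mem_iota.
move=> /(_ L) [|col [colL colP]].
  move=> z; pose t := if z is inr p then forb p else [::].
  have := card_fset_filter_notin K t.
  suff : size t <= d by rewrite -/(L z); move: le_K; lia.
  rewrite /t; case: z {t} => // p; rewrite /forb; case: ifP => //.
  by rewrite inE size_map -cardE.
have colK z : col z < K by have := colL z; rewrite LE => /andP[].
pose c : {ffun A -> 'I_K} := [ffun a => Ordinal (colK (inl a))].
pose va a : glue {ffun A -> 'I_K} F := inl a.
pose vb b : glue {ffun A -> 'I_K} F := inr (b, c).
(* These [#|A| + #|Sd|] colours are pairwise distinct but all below [K]. *)
pose s := [seq col (va a) | a <- enum A] ++ [seq col (vb b) | b <- enum Sd].
have : size s <= size (iota 0 K).
  apply: uniq_leq_size => [|x]; last first.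
    by rewrite mem_cat => /orP[] /mapP[y _ ->]; rewrite mem_iota colK.
  rewrite cat_uniq; apply/and3P; split.
  - rewrite map_inj_uniq ?enum_uniq // => a a' E; apply/eqP/negPn/negP => aa'.
    exact: (colP (va a) (va a')).
  - apply/hasPn => _ /mapP[b + ->]; rewrite mem_enum => bS.
    apply/negP => /mapP[a _ E].
    have [abF|abF] := boolP ((a, b) \in F); last exact: (colP (vb b) (va a)).
    have := colL (vb b); rewrite LE => /andP[/negP + _]; apply.
    rewrite /forb /= bS; apply/mapP; exists a; first by rewrite mem_enum inE.
    by rewrite E ffunE.
  - rewrite map_inj_uniq ?enum_uniq // => b b' E; apply/eqP/negPn/negP => bb'.
    by apply: (colP (vb b) (vb b')) => //=; rewrite eqxx.
rewrite size_iota size_cat !size_map -enumT -!cardE => le.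
by have := leq_trans ltK le; rewrite ltnn.
Qed.

(** * Connectivity of [H] and complete graphs *)

(** Deleting fewer than [kap] neighbours of [h] would isolate it from a remaining vertex. *)
Lemma k_connected_degree (H : sgraph) kap (h : H) :
  k_connected H kap -> kap <= #|[set h' | adj h h']|.
Proof.
case/andP=> ltkN /forall_inP conH; rewrite leqNgt; apply/negP => ltk.
set X := [set h' | adj h h'] in ltk.
have hX : h \in ~: X by rewrite !inE adj_irrefl.
have : 0 < #|(~: X) :\ h|.
  have := cardsC X; have := cardsD1 h (~: X); rewrite hX.
  by move: ltkN; rewrite /nvertices; lia.
case/card_gt0P=> y /setD1P[yh yX].
have chy : forall u v, [&& u \in ~: X, v \in ~: X & adj u v] -> (u == h) = (v == h).
  move=> u v /and3P[]; rewrite !inE => uX vX uv.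
  case: (eqVneq u h) uX uv => [->|uh] uX uv; first by rewrite uv in vX.
  by case: (eqVneq v h) uX uv => [->|//] uX; rewrite adj_sym (negPf uX).
have /connected_onP/(_ h y hX yX)/(connect_eq chy) := conH X ltk.
by rewrite eqxx (negPf yh).
Qed.

(** A nonempty graph is 0-connected, so the maximum ranges over a nonempty set and is attained. *)
Lemma kappa_connected (H : sgraph) : 0 < nvertices H -> k_connected H (kappa H).
Proof.
move=> N0; have := @eq_bigmax_cond _ [pred k : 'I_(nvertices H) | k_connected H k]
  (@nat_of_ord _).
case=> [|k kP E].
  apply/card_gt0P; exists (Ordinal N0); rewrite inE /k_connected /= N0 /=.
  exact/forallP.
by rewrite /kappa (_ : \max_(_ < _ | _) _ = k).
Qed.

Definition complete_rel n : rel 'I_n := fun i j => i != j.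

Lemma complete_rel_sym n : symmetric (@complete_rel n).
Proof. by move=> i j; rewrite /complete_rel eq_sym. Qed.

Lemma complete_rel_irrefl n : irreflexive (@complete_rel n).
Proof. by move=> i; rewrite /complete_rel eqxx. Qed.

Definition complete n : sgraph :=
  SGraph (@complete_rel_sym n) (@complete_rel_irrefl n).

Lemma complete_minor_free (H : sgraph) n : n < nvertices H -> ~ minor H (complete n).
Proof.
move=> ltnN [Br [Br0 _ Brd _]].
pose g h := xchoose (set0Pn _ (Br0 h)).
have gP h : g h \in Br h by apply: (xchooseP (set0Pn _ (Br0 h))).
have ginj : injective g.
  move=> h h' E; apply/eqP/negPn/negP => /Brd/pred0P/(_ (g h)) /=.
  by rewrite gP E gP.
by have := leq_card _ ginj; rewrite card_ord leqNgt ltnN.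
Qed.

Lemma leq_list_chromatic_complete n : n <= list_chromatic (complete n).
Proof.
case: n => // n; apply: lt_list_chromatic => /(_ (fun=> [fset x in iota 0 n]%fset)).
case=> [v|col [colL colP]]; first by rewrite card_fseq undup_id ?iota_uniq // size_iota.
have ltn v : col v < n by have := colL v; rewrite !inE mem_iota.
have inj : injective (fun v : 'I_n.+1 => Ordinal (ltn v)).
  move=> v w [E]; apply/eqP/negPn/negP => vw; exact: (colP v w).
by have := leq_card _ inj; rewrite !card_ord ltnn.
Qed.

(** * Numerical estimates for the union bound *)

Lemma expn_ge_bernoulli d n : d ^ n.+1 + n.+1 * d ^ n <= d.+1 ^ n.+1.
Proof.
elim: n => [|n IHn]; first by rewrite !expn1 expn0; lia.
rewrite (expnS d.+1); apply: leq_trans (leq_mul (leqnn _) IHn).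
rewrite !expnS; move: (d ^ n) => y.
by rewrite !(mulSn, mulnS, mulnDr, mulnDl, mulnA, mul1n); lia.
Qed.

Lemma double_expn_pred D : 0 < D -> 2 * D.-1 ^ D <= D ^ D.
Proof.
case: D => // d _ /=; apply: leq_trans (expn_ge_bernoulli d d).
by rewrite expnS mulSn; lia.
Qed.

Lemma poly_lt_exp2 C M : exists t0, forall t, t0 <= t -> C * t.+1 ^ M < 2 ^ t.
Proof.
pose M2 := 2 * M.+1; exists (C + M2 * M2) => t le_t.
have t_ge : C < t.+1 by lia.
(* The extra factor [t.+1] absorbs [C]. *)
suff : t.+1 ^ M.+1 <= 2 ^ t.
  by apply: leq_trans; rewrite expnS ltn_mul2r expn_gt0 /= t_ge.
pose s := t %/ M2.
have M2_gt0 : 0 < M2 by [].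
have sM : s * M2 <= t by apply: leq_trunc_div.
have ts : t.+1 <= s.+1 * M2 by apply: ltn_ceil.
have ts2 : t.+1 <= s.+1 ^ 2.
  rewrite -mulnn; rewrite leqNgt; apply/negP => lt_s.
  have : M2 * M2 < t.+1 by lia.
  clearbody s M2; nia.
apply: (leq_trans (n := (s.+1 ^ 2) ^ M.+1)); first by rewrite leq_exp2r.
rewrite -expnM; apply: (leq_trans (n := (2 ^ s) ^ M2)); first by rewrite leq_exp2r // ltn_expl.
by rewrite -expnM leq_exp2l.
Qed.

(** The failure probability is about [2 ^ -(s^2 / D)] by [double_expn_pred], while the number of
    labellings grows only like [exp (O(s log s))]. *)
Lemma poly_expn_mul_pred_lt q c c' D : 0 < q -> 0 < D -> exists s0, forall s, s0 <= s ->
  q * (c * s) ^ (c' * s) * D.-1 ^ (s * s) < D ^ (s * s).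
Proof.
move=> q_gt0 D_gt0.
have [t0 t0P] := poly_lt_exp2 (q * (c * D) ^ c') c'.
exists (t0 * D).+1 => s le_s.
have s_gt0 : 0 < s by lia.
pose t := s %/ D.
have sD : t * D <= s by apply: leq_trunc_div.
have ts : s <= t.+1 * D by apply/ltnW/ltn_ceil.
have le_t : t0 <= t by rewrite /t leq_divRL //; lia.
have DD : 2 ^ (t * s) * D.-1 ^ (s * s) <= D ^ (s * s).
  have -> : s * s = D * (t * s) + (s - t * D) * s.
    by rewrite mulnA -mulnDl [D * t]mulnC subnKC.
  rewrite !expnD mulnA; apply: leq_mul.
    move: (t * s) => m; rewrite !(expnM _ D) -expnMn; case: m => // m.
    by rewrite leq_exp2r // double_expn_pred.
  by case: ((s - t * D) * s) => // m; rewrite leq_exp2r // leq_pred.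
(* After taking [s]-th roots, [s <= t.+1 * D] leaves a polynomial in [t] against [2 ^ t]. *)
have lt2 : q * (c * s) ^ (c' * s) < 2 ^ (t * s).
  apply: (leq_ltn_trans (n := (q * (c * s) ^ c') ^ s)).
    by rewrite expnM [X in _ <= X]expnMn leq_mul2r -{1}(expn1 q) leq_pexp2l ?orbT.
  rewrite expnM ltn_exp2r //; apply: leq_ltn_trans (t0P _ le_t).
  rewrite -mulnA -expnMn leq_mul2l; apply/orP; right.
  case: (c') => // n; rewrite leq_exp2r //.
  by rewrite -mulnA leq_mul2l [D * _]mulnC ts orbT.
have [->|Y_gt0] := posnP (D.-1 ^ (s * s)).
  by rewrite muln0 expn_gt0 D_gt0.
by apply: leq_trans DD; rewrite ltn_pmul2r.
Qed.

(** * Choice of parameters and conclusion *)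

(** An integer form with [6 / e] for [eps]. In the main case, shrinking [A] and [B] costs at most
    [4N/e], the shortened lists [#|A|/e], and the vertices of large [F]-degree [#|B|/e]. *)
Lemma f_ell_lower_bound e : 2 < e -> exists n0, forall H : sgraph,
  n0 <= nvertices H ->
  e * (nvertices H + kappa H) <= e * f_ell H + 6 * (nvertices H + kappa H).
Proof.
(* One factor [e] of [q] bounds the degree [d], the other the share of exceptional vertices; [k]
   makes [k * s] at least [2 * N]. *)
move=> e_gt2; set q := e * e; set k := 4 * e.
have q_gt0 : 0 < q by rewrite muln_gt0; lia.
have D_gt0 : 0 < q ^ (k * k) by rewrite expn_gt0 q_gt0.
have [s0 s0P] := poly_expn_mul_pred_lt (2 * e) k q_gt0 D_gt0.
exists (e * s0.+1) => H.
set N := nvertices H; set kap := kappa H => leN.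
pose s := N %/ e.
have sN : s * e <= N by apply: leq_trunc_div.
have Ns : N < s.+1 * e by apply: ltn_ceil; lia.
have s_ge : s0 < s by rewrite /s leq_divRL; lia.
have N_ge : e <= N by nia.
(* For small [kap], the complete graph on [N.-1] vertices loses only [kap] and 1, with
   [e * kap < 2 * N] and [e <= N]. *)
have [lt_kap|le_kap] := ltnP kap (2 * s).
  have ltN : N.-1 < nvertices H by rewrite -/N; lia.
  have := list_chromatic_le_f_ell (complete_minor_free ltN).
  have := leq_list_chromatic_complete N.-1 => h1 h2.
  have le_f := leq_mul (leqnn e) (leq_trans h1 h2).
  by have : e * N = e * N.-1 + e by [nia]; nia.
have N_gt0 : 0 < N by lia.
have kc : k_connected H kap := kappa_connected N_gt0.
have kapN : kap < N by case/andP: kc.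
pose A := 'I_(kap - 2 * s); pose B := 'I_(N - 2 * s).
have cA : #|A| = kap - 2 * s by apply: card_ord.
have cB : #|B| = N - 2 * s by apply: card_ord.
have B_gt0 : 0 < #|B| by rewrite cB; nia.
have [|||||F [Fq FP]] := @sparse_bipartite H A B q k s kap _ _ _ _ q_gt0.
- by move=> h; apply: k_connected_degree.
- by rewrite cA cB /k; nia.
- by rewrite cA; lia.
- by rewrite cB -/N; nia.
- apply: leq_ltn_trans (s0P s (ltnW s_ge)).
  rewrite leq_mul2r leq_mul2l; apply/orP; right; apply/orP; right.
  apply: (@leq_trans ((2 * e * s) ^ (#|A| + #|B|))).
    have : N.+1 <= 2 * e * s by nia.
    by case: (_ + _) => // m; rewrite leq_exp2r.
  rewrite leq_pexp2l //; first by rewrite !muln_gt0; lia.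
  by rewrite cA cB /k; nia.
pose d := #|A| %/ e; pose Sd := small_degree F d.
have ltAd : #|A| < d.+1 * e by apply: ltn_ceil; lia.
have dA : d * e <= #|A| by apply: leq_trunc_div.
(* Markov's inequality for [F]-degrees, with [#|A| < d.+1 * e] cancelling one factor [e] of [q]. *)
have bad_le : e * #|~: Sd| <= #|B|.
  have := card_small_degree F d; rewrite -/Sd => le_F.
  have := leq_mul (leqnn q) le_F => le_qF; have {le_qF} := leq_trans le_qF Fq.
  have := leq_mul (ltnW ltAd) (leqnn #|B|) => h1 h2; have {h1 h2} := leq_trans h2 h1.
  have -> : q * (#|~: Sd| * d.+1) = (d.+1 * e) * (e * #|~: Sd|) by rewrite /q; lia.
  by rewrite leq_pmul2l // muln_gt0; lia.
have SdB : #|Sd| + #|~: Sd| = #|B| := cardsC Sd.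
have Sd_gt0 : 0 < #|Sd| by nia.
have d_le : d <= #|A| by nia.
(* One colour too few; the strict bound of [lt_list_chromatic] regains this unit. *)
pose K := (#|A| + #|Sd|).-1.
have nch : ~ choosable (glue {ffun A -> 'I_K} F) (K - d).
  have dK : d <= K by rewrite /K -ltnS prednK ?addn_gt0 ?Sd_gt0 ?orbT // -addn1 leq_add.
  apply: (@glue_not_choosable _ _ _ d); last by rewrite subnK.
  by rewrite -/Sd /K prednK ?addn_gt0 ?Sd_gt0 ?orbT.
have nm : ~ minor H (glue {ffun A -> 'I_K} F).
  by apply: glue_minor_free kc _ FP; rewrite cA; lia.
have := leq_trans (lt_list_chromatic nch) (list_chromatic_le_f_ell nm).
move=> le_f; have {}le_f : #|A| + #|Sd| <= f_ell H + d by move: le_f; rewrite /K; lia.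
have := leq_mul (leqnn e) le_f; rewrite !mulnDr.
have : e * #|Sd| + e * #|~: Sd| = e * #|B| by rewrite -mulnDr SdB.
have : e * #|A| + 2 * (e * s) = e * kap by rewrite cA; nia.
have : e * #|B| + 2 * (e * s) = e * N by rewrite cB; nia.
move: sN bad_le dA SdB cA cB; rewrite ![_ * e]mulnC; lia.
Qed.

Import Order.TTheory GRing.Theory Num.Theory.
Local Open Scope ring_scope.

Theorem theorem1p5 (R : realType) (eps : R) (eps_gt0 : 0 < eps) :
  exists n0 : nat, forall H : sgraph, (n0 <= nvertices H)%N ->
    (1 - eps) * ((nvertices H)%:R + (kappa H)%:R) <= (f_ell H)%:R.
Proof.
have [e e_gt2 e_eps] : exists2 e, (2 < e)%N & 6 <= e%:R * eps.
  (* The Archimedean bound gives [6 <= e * eps], and the added 3 ensures [2 < e]. *)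
  exists (Num.bound (6 / eps)).+3 => //.
  rewrite -ler_pdivrMr //; apply: ltW; apply: lt_le_trans (archi_boundP _) _.
    by rewrite divr_ge0 // ltW.
  by rewrite ler_nat; apply: leqW (leqW (leqW (leqnn _))).
have [n0 n0P] := f_ell_lower_bound e_gt2; exists n0 => H /n0P.
rewrite -natrD -(ler_nat R) [X in _ <= X -> _]natrD !natrM.
set x : R := (_ + _)%:R; set f : R := (f_ell H)%:R => le_f.
have e_gt0 : 0 < e%:R :> R by rewrite ltr0n; lia.
rewrite -(ler_pM2l e_gt0) mulrA mulrBr mulr1 mulrBl lerBlDr.
by apply: le_trans le_f _; rewrite lerD2l ler_wpM2r // ler0n.
Qed.
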